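(* Let $G$ be a connected simple graph with an odd number of vertices. Suppose that $G$ has exactly one vertex of even degree, say $w$. If $w$ is adjacent to all other vertices of $G$ and $G-w$ is connected, then $\chi'_o(G)\le 3$, unless $G$ is isomorphic to the wheel $W_4$.
   Context: All graphs are finite and simple. For a graph $G$, a subgraph $H$ is an odd subgraph if every vertex of $H$ has odd degree in $H$. $G$ is odd $k$-edge-colorable if there is a map $c:E(G)\to\{1,\dots,k\}$ such that for each $i$ with $c^{-1}(i)\neq\emptyset$, the subgraph formed by the edge set $c^{-1}(i)$ (together with the endpoints of those edges) is an odd subgraph of $G$. The odd chromatic index $\chi'_o(G)$ is the minimum $k$ such that $G$ is odd $k$-edge-colorable. The wheel $W_4$ is the graph obtained from a cycle of length $4$ by adding a new vertex adjacent to all four cycle vertices. *)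

(* Defs.v *)
From mathcomp Require Import all_boot.

Set Implicit Arguments.
Unset Strict Implicit.
Unset Printing Implicit Defensive.

Record sgraph := SGraph {
  vertex :> finType;
  adj : rel vertex;
  adj_sym : symmetric adj;
  adj_irr : irreflexive adj
}.

Arguments adj {s} x y.

Definition degree (G : sgraph) (v : G) : nat := #|[set u : G | adj v u]|.

(* The null graph counts as connected. *)
Definition connected_graph (G : sgraph) : Prop :=
  forall x y : G, connect adj x y.

Definition isomorphic (G H : sgraph) : Prop :=
  exists f : G -> H, bijective f /\ {mono f : x y / adj x y}.

Section DelVertex.
Variables (G : sgraph) (w : G).

Definition del_adj : rel {x : G | x != w} := fun x y => adj (val x) (val y).

Lemma del_adj_sym : symmetric del_adj.
Proof. by move=> x y; apply: adj_sym. Qed.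

Lemma del_adj_irr : irreflexive del_adj.
Proof. by move=> x; apply: adj_irr. Qed.

Definition del_vertex : sgraph := SGraph del_adj_sym del_adj_irr.
End DelVertex.

(* [None] is the hub; [ordS] is the cyclic successor on 'I_4. *)
Definition W4_adj : rel (option 'I_4) := fun x y =>
  match x, y with
  | Some i, Some j => (ordS i == j) || (ordS j == i)
  | None, None => false
  | _, _ => true
  end.

Lemma W4_adj_sym : symmetric W4_adj.
Proof. by move=> [i|] [j|] //=; rewrite orbC. Qed.

Lemma W4_adj_irr : irreflexive W4_adj.
Proof. by move=> [[[|[|[|[|i]]]] Hi]|]. Qed.

Definition W4 : sgraph := SGraph W4_adj_sym W4_adj_irr.

Section OddEdgeColoring.
Variable G : sgraph.

Definition edges : {set {set G}} :=
  [set [set p.1; p.2] | p in [pred p : G * G | adj p.1 p.2]].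

Definition edge : finType := {f : {set G} | f \in edges}.

(* An edge set F is identified with the subgraph it forms, whose vertex set,
   the endpoints of the edges in F, is [cover F]. *)
Definition degree_in (F : {set {set G}}) (v : G) : nat :=
  #|[set f in F | v \in f]|.

Definition odd_subgraph (F : {set {set G}}) : bool :=
  [forall v in cover F, odd (degree_in F v)].

Definition color_class (k : nat) (c : {ffun edge -> 'I_k}) (i : 'I_k) :
    {set {set G}} :=
  [set val f | f in [pred f : edge | c f == i]].

Definition odd_edge_colorable (k : nat) : bool :=
  [exists c : {ffun edge -> 'I_k},
    [forall i, (color_class c i != set0) ==> odd_subgraph (color_class c i)]].

Lemma ex_odd_edge_colorable : exists k, odd_edge_colorable k.
Proof.
exists #|edge|; apply/existsP; exists [ffun f => enum_rank f].
apply/forallP => i; apply/implyP => _; apply/forallP => v; apply/implyP.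
set F := color_class _ i.
have -> : F = [set val (enum_val i)].
  apply/setP => f; rewrite inE; apply/imsetP/eqP => [[g]|->].
    by rewrite inE ffunE => /eqP <- ->; rewrite enum_rankK.
  by exists (enum_val i) => //; rewrite inE ffunE enum_valK.
rewrite /cover big_set1 => vi; rewrite /degree_in.
suff -> : [set f in [set val (enum_val i)] | v \in f] = [set val (enum_val i)].
  by rewrite cards1.
by apply/setP => f; rewrite !inE; case: eqP => // ->.
Qed.

Definition odd_chromatic_index : nat := ex_minn ex_odd_edge_colorable.
End OddEdgeColoring.

(* Main.v *)
(** Put [V = G - w]; it is connected, of even order, with all degrees even.
    Suppose we find [a] in [V] and an even set [S] in [V - a] containing all
    neighbours of [a] in [V] such that [G[S]] has a spanning odd subgraph [X].
    Give [X] one colour, a second colour to all edges at [a] and to the edges [ws]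
    with [s] in [S] not adjacent to [a], and the third colour to the rest: vertices
    outside [S] and [w] see one colour, those of [S] see the second colour exactly
    once, and at [w] the second colour has degree [1 + |S| - |N(a) - w|], which is
    odd.
    If some [a] has two neighbours [x], [y] in [V], such an [S] is [{x, y}], the ends
    of a 2-matching, or a claw containing [x] and [y], unless [V] is a 4-cycle.
    Otherwise all degrees in [V] are at least 4, and [V], having even order, is not
    complete; as in the proof of Brooks' theorem there are nonadjacent [a], [b] with
    [V - a - b] connected, and [S = V - a - b] works because an even connected set
    has a spanning odd subgraph. *)

Require Import Defs.
From mathcomp Require Import all_boot.

Set Implicit Arguments.
Unset Strict Implicit.
Unset Printing Implicit Defensive.

Lemma setU1_neq0 (T : finType) (x : T) (A : {set T}) : x |: A != set0.
Proof. by apply/set0Pn; exists x; rewrite setU11. Qed.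

Lemma cardsD2 (T : finType) (A : {set T}) x y :
  x \in A -> y \in A -> x != y -> #|A :\ x :\ y| = #|A| - 2.
Proof.
move=> xA yA xy; rewrite (cardsD1 x A) xA (cardsD1 y (A :\ x)) !inE eq_sym xy yA.
by rewrite !add1n subn2.
Qed.

(** * Connected induced subgraphs, non-cut vertices and T-joins *)

Section Linked.
Variable G : sgraph.
Implicit Types (a b k r u v w x y z : G) (K M R S T V : {set G}).

(* Connectedness of the induced subgraph, phrased by cuts. *)
Definition linked S : bool :=
  [forall M : {set G}, (M \proper S) && (M != set0) ==>
     [exists u in M, exists v in S :\: M, adj u v]].

Lemma linkedP S :
  reflect (forall M, M \proper S -> M != set0 ->
             exists u v, [/\ u \in M, v \in S, v \notin M & adj u v])
          (linked S).
Proof.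
apply: (iffP forallP) => [lS M pMS M0 | lS M].
  have /implyP := lS M; rewrite pMS M0 => /(_ isT) /exists_inP[u uM].
  by case/exists_inP=> v; rewrite inE => /andP[vM vS] uv; exists u, v.
apply/implyP=> /andP[pMS M0]; have [u [v [uM vS vM uv]]] := lS M pMS M0.
by apply/exists_inP; exists u => //; apply/exists_inP; exists v; rewrite // inE vM.
Qed.

Lemma linked1 x : linked [set x].
Proof.
apply/linkedP=> M; rewrite properE subset1 => /andP[/orP[/eqP->|->//]].
by rewrite subxx.
Qed.

(** A cut of [S :|: R] either splits [S], and then an edge inside [S] crosses it, or leaves [S] on
    one side, and then a vertex of [R] on the other side has its edge into [S]. *)
Lemma linked_setU S R :
  linked S -> S != set0 -> {in R, forall y, exists2 x, x \in S & adj x y} ->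
  linked (S :|: R).
Proof.
move=> /linkedP lS /set0Pn[x0 x0S] RS; apply/linkedP=> M /properP[sM [z zSR zM]].
case/set0Pn=> y yM.
have [sSM|/subsetPn[s sS sM']] := boolP (S \subset M).
  have zR : z \in R by case/setUP: zSR => // /(subsetP sSM); rewrite (negPf zM).
  by have [x xS xz] := RS z zR; exists x, z; rewrite (subsetP sSM).
have [MS0|] := eqVneq (M :&: S) set0.
  have MnS t : t \in S -> t \notin M.
    by move=> tS; apply/negP=> tM; have := in_set0 t; rewrite -MS0 inE tM tS.
  have yR : y \in R.
    by have := subsetP sM y yM; case/setUP=> // /MnS; rewrite yM.
  have [x xS xy] := RS y yR; exists y, x.
  by rewrite yM inE xS MnS // adj_sym xy.
case/(lS (M :&: S)) => [|u [v [/setIP[uM _] vS vM uv]]].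
  apply/properP; split; first exact: subsetIr.
  by exists s; rewrite // inE (negPf sM').
by exists u, v; split; rewrite // ?inE ?vS //; move: vM; rewrite inE vS andbT.
Qed.

Lemma linkedU1 S x y : linked S -> x \in S -> adj x y -> linked (y |: S).
Proof.
move=> lS xS xy; rewrite setUC; apply: linked_setU => //.
  by apply/set0Pn; exists x.
by move=> _ /set1P->; exists x.
Qed.

(** Grow a connected set from [[set x]] inside [K], one neighbour at a time: the last vertex added
    is a non-cut vertex of [K] other than [x]. *)
Lemma linkedD1 K x :
  linked K -> x \in K -> K != [set x] ->
  exists k, [/\ k \in K, k != x & linked (K :\ k)].
Proof.
move=> /linkedP lK xK K1.
suff grow n M : #|K| - #|M| <= n -> linked M -> x \in M -> M \proper K ->
    exists k, [/\ k \in K, k != x & linked (K :\ k)].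
  apply: (grow #|K| [set x]); rewrite ?linked1 ?set11 ?leq_subr //.
  by rewrite properEneq eq_sym K1 sub1set.
elim: n M => [|n IH] M leMn lM xM pMK.
  by rewrite leqNgt subn_gt0 proper_card in leMn.
have [|u [v [uM vK vM uv]]] := lK M pMK; first by apply/set0Pn; exists x.
have lvM := linkedU1 lM uM uv.
have svM : v |: M \subset K by rewrite subUset sub1set vK proper_sub.
have [eqK|neqK] := eqVneq (v |: M) K.
  exists v; split=> //; first by apply: contraNneq vM => ->.
  by rewrite -eqK setU1K.
apply: (IH (v |: M)); rewrite ?properEneq ?neqK // ?cardsU1 ?vM ?inE ?xM ?orbT //.
by rewrite add1n subnS; case: (_ - _) leMn.
Qed.

(* Existence of T-joins, by induction on [S]: remove a non-cut vertex [k] and, if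
   [k] is in [T], add an edge [kz] and flip the parity required at [z]. *)
Lemma linked_join S T :
  linked S -> T \subset S -> ~~ odd #|T| ->
  exists X : rel G, [/\ symmetric X, subrel X adj,
    forall u v, X u v -> u \in S &
    forall v, odd #|[set u | X v u]| = (v \in T)].
Proof.
move: {2}#|S| (leqnn #|S|) => n; elim: n S T => [|n IH] S T leS lS sTS oT.
  have T0 : T = set0 by apply/eqP; rewrite -cards_eq0 -leqn0 (leq_trans (subset_leq_card sTS)).
  exists (fun _ _ => false); split=> // v.
  by rewrite T0 inE (_ : [set u | false] = set0) ?cards0 //; apply/setP=> u; rewrite !inE.
have [T0|/set0Pn[x xT]] := eqVneq T set0.
  exists (fun _ _ => false); split=> // v.
  by rewrite T0 inE (_ : [set u | false] = set0) ?cards0 //; apply/setP=> u; rewrite !inE.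
have xS := subsetP sTS x xT.
have S1 : S != [set x].
  apply: contraNneq oT => S1; suff ->: T = [set x] by rewrite cards1.
  by apply/eqP; rewrite eqEsubset -{1}S1 sTS sub1set.
have [k [kS _ lSk]] := linkedD1 lS xS S1.
have leSk : #|S :\ k| <= n by move: leS; rewrite (cardsD1 k S) kS.
have [kT|kT] := boolP (k \in T); last first.
  have [||X [symX subX XS dX]] := IH (S :\ k) T leSk lSk => //.
    by rewrite subsetD1 sTS.
  by exists X; split=> // u v /XS /setD1P[].
have [||_ [z [/set1P-> zS zk kz]]] := linkedP _ lS [set k].
- rewrite properEneq sub1set kS andbT eq_sym.
  apply: contraNneq oT => S1'; suff ->: T = [set k] by rewrite cards1.
  by apply/eqP; rewrite eqEsubset -{1}S1' sTS sub1set.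
- by apply/set0Pn; exists k; rewrite set11.
rewrite inE in zk.
(* [T'] is the symmetric difference of [T] and the pair [k], [z], so its size has the parity of
   [#|T|] and it avoids [k]. *)
pose T' := if z \in T then T :\ k :\ z else z |: (T :\ k).
have memT' u : (u \in T') = (u != k) && ((u \in T) (+) (u == z)).
  rewrite /T'; case: ifP => zT; rewrite !inE.
    by case: (eqVneq u z) => [->|_]; rewrite ?zT ?andbF ?addbF.
  by case: (eqVneq u z) => [->|_]; rewrite ?zT ?zk ?addbF.
have [||X [symX subX XS dX]] := IH (S :\ k) T' leSk lSk.
- apply/subsetP=> u; rewrite memT' !inE => /andP[->].
  by case: (eqVneq u z) => [->|_]; rewrite ?zS // addbF => /(subsetP sTS).
- move: oT; rewrite /T' (cardsD1 k T) kT.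
  case: ifP => zT; last by rewrite cardsU1 !inE zT andbF.
  by rewrite [#|T :\ k|](cardsD1 z) !inE zk zT /= negbK.
have Xk u : X k u = false by apply/negP=> /XS; rewrite !inE eqxx.
exists (fun u v => [|| X u v, (u == k) && (v == z) | (u == z) && (v == k)]).
split.
- by move=> u v; rewrite symX; congr (_ || _); rewrite orbC ![(_ == k) && _]andbC.
- by move=> u v /or3P[/subX//|/andP[/eqP-> /eqP->]//|/andP[/eqP-> /eqP->]]; rewrite adj_sym.
- by move=> u v /or3P[/XS/setD1P[]//|/andP[/eqP->]//|/andP[/eqP->]].
move=> v; have [->|vk] := eqVneq v k.
  rewrite (_ : [set _ | _] = [set z]) ?cards1 ?kT //.
  by apply/setP=> u; rewrite !inE Xk [k == z]eq_sym (negPf zk) orbF.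
have := dX v; rewrite memT' vk /=; have [->|vz] := eqVneq v z.
  rewrite (_ : [set u | _ || _] = k |: [set u | X z u]).
    rewrite cardsU1 inE symX Xk /= => ->; by case: (z \in T).
  by apply/setP=> u; rewrite !inE orbC.
by rewrite addbF => <-; congr (odd #|pred_of_set _|); apply/setP=> u; rewrite !inE orbF.
Qed.

(** * Nonadjacent pairs whose removal leaves a connected graph *)

Lemma card_nbr_gt2 V v x y :
  2 < #|[set u in V | adj v u]| -> exists u, [/\ u \in V, adj v u, u != x & u != y].
Proof.
move=> dv; have /subsetPn[u] : ~~ ([set u in V | adj v u] \subset [set x; y]).
  apply/negP=> /subset_leq_card; rewrite cards2.
  by case: (x != y) => /(leq_trans dv).
by rewrite !inE negb_or => /andP[uV vu] /andP[ux uy]; exists u.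
Qed.

(** An approximation to the wanted pair: [K] is a connected part of [V - a - b], to be enlarged,
    possibly with a change of pair, until it is all of it. *)
Definition nonadjacent_with V a b K : bool :=
  [&& a \in V, b \in V, a != b, ~~ adj a b, linked K, K != set0
    & K \subset V :\ a :\ b].

Lemma nonadjacent_withC V a b K :
  nonadjacent_with V a b K = nonadjacent_with V b a K.
Proof.
rewrite /nonadjacent_with eq_sym adj_sym.
have -> : V :\ a :\ b = V :\ b :\ a by rewrite !setDDl setUC.
by case: (a \in V); case: (b \in V).
Qed.

(* With [R] the complement of [K] in [V - a - b]: unless one of the obvious moves
   enlarges [K], no edge joins [K] to [R], [a] is adjacent to all of [R], and [b] has
   a neighbour in [R]. Then any [r] in [R] other than that neighbour and a
   non-cut vertex [k] of [K] other than [x] give a pair with [V - r - k] connected. *)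
Lemma enlarge_nonadjacent_aux V a b K x :
  linked V -> {in V, forall v, 2 < #|[set u in V | adj v u]|} ->
  nonadjacent_with V a b K -> K != V :\ a :\ b -> x \in K -> adj x b ->
  exists a' b' K', nonadjacent_with V a' b' K' /\ #|K| < #|K'|.
Proof.
move=> lV dV nK neqK xK xb.
have /and5P[aV bV ab nab /and3P[lK K0 sK]] := nK.
have bigger y : y \notin K -> #|K| < #|y |: K| by move=> yK; rewrite cardsU1 yK.
pose R := V :\ a :\ b :\: K.
have aK : a \notin K by apply/negP=> /(subsetP sK); rewrite !inE eqxx andbF.
have bK : b \notin K by apply/negP=> /(subsetP sK); rewrite !inE eqxx.
have KV y : y \in K -> y \in V by move/(subsetP sK); rewrite !inE => /and3P[].
have RE y : (y \in R) = [&& y \notin K, y != b, y != a & y \in V] by rewrite !inE.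
have [/exists_inP[u uK /exists_inP[r rR ur]]|noKR] :=
    boolP [exists u in K, exists r in R, adj u r].
  move: (rR); rewrite RE => /and4P[rK rb ra rV].
  exists a, b, (r |: K); split; last exact: bigger.
  rewrite /nonadjacent_with aV bV ab nab (linkedU1 lK uK ur) /=.
  by rewrite setU1_neq0 subUset sub1set sK !inE rb ra rV.
have {}noKR u r : u \in K -> r \in R -> ~~ adj u r.
  move=> uK rR; apply: contra noKR => ur.
  by apply/exists_inP; exists u => //; apply/exists_inP; exists r.
(* If some [r] in [R] is not adjacent to [a], replace [b] by [r] in the pair; [b] joins [K] through
   its neighbour [x]. *)
have [/exists_inP[r rR nra]|] := boolP [exists r in R, ~~ adj r a].
  move: (rR); rewrite RE => /and4P[rK rb ra rV].
  exists a, r, (b |: K); split; last exact: bigger.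
  rewrite /nonadjacent_with aV rV [a == r]eq_sym ra adj_sym nra (linkedU1 lK xK xb) /=.
  rewrite setU1_neq0 subUset sub1set !inE [b == r]eq_sym rb [b == a]eq_sym ab bV /=.
  apply/subsetP=> u uK; have := subsetP sK u uK; rewrite !inE.
  by case/and3P=> _ -> ->; rewrite !andbT; apply: contraNneq rK => <-.
rewrite negb_exists_in => /forall_inP Ra.
have {}Ra r : r \in R -> adj r a by move/Ra; rewrite negbK.
have /set0Pn[r1 r1R] : R != set0.
  by rewrite setD_eq0; apply: contra neqK => ?; rewrite eqEsubset sK.
(* An edge leaving [b |: K] ends in [R] or at [a]. In [R], it must start at [b]. At [a], it starts
   in [K], so [a] can join [K] with [b], [r1] as the new pair, unless [b] is adjacent to [r1]. *)
have [|[r0 r0R br0]] :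
    (exists a' b' K', nonadjacent_with V a' b' K' /\ #|K| < #|K'|) \/
    exists2 r0, r0 \in R & adj b r0.
- have [||u [v [ubK vV vbK uv]]] := linkedP _ lV (b |: K).
  + apply/properP; split; last by exists a; rewrite // !inE negb_or ab.
    by rewrite subUset sub1set bV; apply/subsetP.
  + exact: setU1_neq0.
  move: vbK; rewrite !inE negb_or => /andP[vb vK].
  have [va|va] := eqVneq v a; last first.
    have vR : v \in R by rewrite RE vK vb va.
    case/setU1P: ubK => [uE|uK]; first by right; exists v; rewrite // -uE.
    by have := noKR u v uK vR; rewrite uv.
  have uK : u \in K.
    by case/setU1P: ubK => // uE; move: nab; rewrite adj_sym -uE -va uv.
  have [br1|nbr1] := boolP (adj b r1); first by right; exists r1.
  move: (r1R); rewrite RE => /and4P[rK rb ra rV].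
  left; exists b, r1, (a |: K); split; last exact: bigger.
  rewrite /nonadjacent_with bV rV [b == r1]eq_sym rb nbr1.
  rewrite va in uv; rewrite (linkedU1 lK uK uv) setU1_neq0 /=.
  rewrite subUset sub1set !inE [a == r1]eq_sym ra ab aV /=.
  apply/subsetP=> t tK; have := subsetP sK t tK; rewrite !inE.
  by case/and3P=> -> _ ->; rewrite ?andbT; apply: contraNneq rK => <-.
- by [].
move: (r0R); rewrite RE => /and4P[r0K r0b r0a r0V].
(* A neighbour of [r0] other than [a] and [b] lies in [R], since no edge joins [R] to [K]; in the
   same way a third neighbour of [x] lies in [K], so [K] is more than [x]. *)
have [r rR rr0] : exists2 r, r \in R & r != r0.
  have [r [rV r0r ra rb]] := card_nbr_gt2 a b (dV r0 r0V).
  exists r; last by apply: contraTneq r0r => ->; rewrite adj_irr.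
  rewrite RE rb ra rV !andbT; apply/negP=> /noKR/(_ r0R).
  by rewrite adj_sym r0r.
have K1 : K != [set x].
  have [u [uV xu ua ub]] := card_nbr_gt2 a b (dV x (KV x xK)).
  apply: contraL xu => /eqP K1; have [uK|uK] := boolP (u \in K).
    by move: uK; rewrite K1 => /set1P->; rewrite adj_irr.
  by apply: noKR; rewrite // RE uK ub ua.
have [k [kK kx lKk]] := linkedD1 lK xK K1.
move: (rR); rewrite RE => /and4P[rK rb ra rV].
have xKk : x \in K :\ k by rewrite !inE eq_sym kx.
(* The right side lists the vertices in an order that shows connectedness: [b] hangs on [x], [r0] on
   [b], [a] on [r0], and the rest of [R] on [a]. *)
have VE : V :\ r :\ k = (a |: (r0 |: (b |: (K :\ k)))) :|: (R :\ r).
  apply/setP=> u; rewrite !inE.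
  have [->|uk] := eqVneq u k.
    have kne t : t \notin K -> (k == t) = false.
      by move=> tK; apply: contraNF tK => /eqP<-.
    by rewrite (kne a) // (kne r0) // (kne b) // kK andbF.
  have [->|ur] := eqVneq u r.
    by rewrite (negPf ra) (negPf rr0) (negPf rb) (negPf rK).
  have [->|ua] := eqVneq u a; first by rewrite aV.
  have [->|ub] := eqVneq u b; first by rewrite bV orbT.
  have [->|ur0] := eqVneq u r0; first by rewrite r0V.
  have [uK|uK] := boolP (u \in K); first by rewrite KV.
  by [].
(* The new set has [#|V| - 2] elements, as many as [V :\ a :\ b], of which [K] is a proper
   subset. *)
exists r, k, (V :\ r :\ k); split; last first.
  have rk : r != k by apply: contraNneq rK => ->.
  rewrite (cardsD2 rV (KV k kK) rk) -(cardsD2 aV bV ab).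
  by apply: proper_card; rewrite properEneq neqK.
rewrite /nonadjacent_with rV KV // (_ : r != k); last by apply: contraNneq rK => ->.
rewrite adj_sym noKR // subxx {2}VE !andbT /=; apply/andP; split; last first.
  by apply/set0Pn; exists a; rewrite !inE eqxx.
rewrite VE; apply: linked_setU; last 1 first.
- move=> y /setD1P[_ yR]; exists a; first by rewrite !inE eqxx.
  by rewrite adj_sym Ra.
- apply: (@linkedU1 _ r0); [|by rewrite !inE eqxx|exact: Ra].
  apply: (@linkedU1 _ b); [|by rewrite !inE eqxx|by []].
  exact: linkedU1 xb.
by apply/set0Pn; exists a; rewrite !inE eqxx.
Qed.

(** Some edge leaves [K] within [V]. If it ends at [a] or [b], the previous lemma applies, the pair
    being unordered; any other end is added to [K]. *)
Lemma enlarge_nonadjacent V a b K :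
  linked V -> {in V, forall v, 2 < #|[set u in V | adj v u]|} ->
  nonadjacent_with V a b K -> K != V :\ a :\ b ->
  exists a' b' K', nonadjacent_with V a' b' K' /\ #|K| < #|K'|.
Proof.
move=> lV dV nK neqK; have /and5P[aV bV ab nab /and3P[lK K0 sK]] := nK.
have [||x [v [xK vV vK xv]]] := linkedP _ lV K => //.
  apply/properP; split.
    by rewrite (subset_trans sK) // (subset_trans (subD1set _ _)) ?subD1set.
  by exists a; rewrite //; apply/negP=> /(subsetP sK); rewrite !inE eqxx andbF.
have [vb|vb] := eqVneq v b.
  by rewrite vb in xv; exact: (enlarge_nonadjacent_aux lV dV nK neqK xK xv).
have [va|va] := eqVneq v a.
  rewrite va in xv; rewrite nonadjacent_withC in nK.
  apply: (enlarge_nonadjacent_aux lV dV nK _ xK xv).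
  by rewrite setDDl setUC -setDDl.
exists a, b, (v |: K); split; last by rewrite cardsU1 vK.
rewrite /nonadjacent_with aV bV ab nab (linkedU1 lK xK xv) setU1_neq0 /=.
by rewrite subUset sub1set sK !inE vb va vV.
Qed.

(** Begin with a single vertex other than [a] and [b] as [K] and enlarge; sizes are bounded by
    [#|V|], so eventually [K] is all of [V] but the current pair. *)
Lemma nonadjacent_noncut V a b :
  linked V -> {in V, forall v, 2 < #|[set u in V | adj v u]|} ->
  a \in V -> b \in V -> a != b -> ~~ adj a b ->
  exists x y, [/\ x \in V, y \in V, x != y, ~~ adj x y & linked (V :\ x :\ y)].
Proof.
move=> lV dV aV bV ab nab.
suff grow n x y K : #|V| - #|K| <= n -> nonadjacent_with V x y K ->
    exists x y, [/\ x \in V, y \in V, x != y, ~~ adj x y & linked (V :\ x :\ y)].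
  have [z [zV az za zb]] := card_nbr_gt2 a b (dV a aV).
  apply: (grow #|V| a b [set z]); first exact: leq_subr.
  rewrite /nonadjacent_with aV bV ab nab linked1 sub1set !inE zb za zV !andbT /=.
  by apply/set0Pn; exists z; rewrite set11.
elim: n x y K => [|n IH] x y K leKn nK.
all: have /and5P[xV yV xy nxy /and3P[lK K0 sK]] := nK.
all: have [KE|KE] := eqVneq K (V :\ x :\ y); first by exists x, y; rewrite -KE.
all: have [x' [y' [K' [nK' ltK]]]] := enlarge_nonadjacent lV dV nK KE.
all: have /and5P[_ _ _ _ /and3P[_ _ sK']] := nK'.
all: have leK' : #|K'| <= #|V| by apply/subset_leq_card/(subset_trans sK')/subsetP=> u;
       rewrite !inE => /and3P[].
- by move: leKn; rewrite leqNgt subn_gt0 (leq_trans ltK leK').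
- apply: IH nK'; rewrite -ltnS (leq_trans _ leKn) // ltn_sub2l //.
  exact: leq_trans ltK leK'.
Qed.

End Linked.

(** * Even sets with a spanning odd subgraph, and the choice of [a] and [S] *)

Section Joinable.
Variable G : sgraph.
Implicit Types (a c u v x y z : G) (S V : {set G}).

(** [X] is the edge set of a spanning odd subgraph of [G[S]], as a symmetric relation; it is the
    T-join of [linked_join] with [T] equal to [S]. *)
Definition joinable S : Prop :=
  exists X : rel G, [/\ symmetric X, subrel X adj,
    forall u v, X u v -> u \in S &
    forall v, odd #|[set u | X v u]| = (v \in S)].

Lemma linked_joinable S : linked S -> ~~ odd #|S| -> joinable S.
Proof. by move=> lS; apply: linked_join. Qed.

Lemma joinable_edge x y : adj x y -> joinable [set x; y].
Proof.
move=> xy; apply: linked_joinable.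
  by rewrite setUC; apply: (@linkedU1 _ _ x); rewrite ?linked1 ?set11.
by rewrite cards2; case: eqP xy => // ->; rewrite adj_irr.
Qed.

Lemma joinableU S T : joinable S -> joinable T -> [disjoint S & T] -> joinable (S :|: T).
Proof.
move=> [X [symX subX XS dX]] [Y [symY subY YT dY]] dST.
exists (fun u v => X u v || Y u v); split.
- by move=> u v; rewrite symX symY.
- by move=> u v /orP[/subX|/subY].
- by move=> u v /orP[/XS uS|/YT uT]; rewrite inE ?uS ?uT ?orbT.
move=> v; rewrite inE -dX -dY.
have -> : [set u | X v u || Y v u] = [set u | X v u] :|: [set u | Y v u].
  by apply/setP=> u; rewrite !inE.
rewrite cardsU (_ : _ :&: _ = set0) ?cards0 ?subn0 ?oddD ?dX ?dY.
  by have := disjointFr dST (x := v); case: (v \in S) => // ->.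
apply/setP=> u; rewrite !inE; apply/negP=> /andP[/XS vS /YT].
by rewrite (disjointFr dST).
Qed.

(** The data of the colouring: [S] carries the colour of the odd subgraph, and [a] is the centre of
    the second colour. *)
Definition join_hub V a S : Prop :=
  [/\ a \in V, S \subset V :\ a, [set u in V | adj a u] \subset S, ~~ odd #|S|
    & joinable S].

Definition is_C4 V a x c y : Prop :=
  [/\ uniq [:: a; x; c; y], V = [set a; x; c; y], [/\ adj a x, adj x c, adj c y & adj y a],
      ~~ adj a c & ~~ adj x y].

(** Let [x], [y] be the neighbours of [a]. If adjacent, they form [S]. If not, each has a further
    neighbour: distinct ones give a 2-matching; a single common one [c] gives a claw at [c] if [c]
    has a third neighbour, and otherwise [a], [x], [c], [y] are closed under adjacency and exhaust
    [V]. *)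
Lemma join_hub_degree2 V a :
  linked V -> {in V, forall v, ~~ odd #|[set u in V | adj v u]|} ->
  a \in V -> #|[set u in V | adj a u]| = 2 ->
  (exists S, join_hub V a S) \/ (exists x c y, is_C4 V a x c y).
Proof.
move=> lV dV aV /eqP/cards2P[x [y [xny Na]]].
have NaE u : (u \in V) && adj a u = (u == x) || (u == y).
  by have := in_set2 u x y; rewrite -Na inE.
have /andP[xV ax] : (x \in V) && adj a x by rewrite NaE eqxx.
have /andP[yV ay] : (y \in V) && adj a y by rewrite NaE eqxx orbT.
have adjN u v : adj u v -> u != v by apply: contraTneq => ->; rewrite adj_irr.
have [xa ya] : x != a /\ y != a by split; rewrite adjN // adj_sym.
have [xy|nxy] := boolP (adj x y).
  left; exists [set x; y]; split; rewrite // ?Na ?cards2 ?xny //.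
    by apply/subsetP=> u; rewrite !inE => /orP[]/eqP->; rewrite ?xa ?ya.
  exact: joinable_edge.
(* The degree of [v] in [V] is even and [a] is one neighbour, so there is another. *)
have other v : v \in V -> adj v a -> exists t, [/\ t \in V, adj v t & t != a].
  move=> vV va; have := dV v vV; rewrite (cardsD1 a) !inE aV va /= negbK => odd_n.
  have /set0Pn[t] : [set u in V | adj v u] :\ a != set0.
    by rewrite -card_gt0; case: #|_| odd_n.
  by rewrite !inE => /and3P[ta tV vt]; exists t.
have [/exists_inP[x1 x1V /exists_inP[y1 y1V /and5P[x1a y1a xx1 yy1 x1y1]]]|noM] :=
    boolP [exists x1 in V, exists y1 in V,
             [&& x1 != a, y1 != a, adj x x1, adj y y1 & x1 != y1]].
  have x1y : x1 != y by apply: contraNneq nxy => <-.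
  have xy1 : x != y1 by apply: contraNneq nxy => ->; rewrite adj_sym.
  have dis : [disjoint [set x; x1] & [set y; y1]].
    rewrite disjoints_subset; apply/subsetP=> u; rewrite !inE negb_or.
    by case/orP=> /eqP->; rewrite ?xny ?xy1 ?x1y ?x1y1.
  left; exists ([set x; x1] :|: [set y; y1]); split=> //.
  - by apply/subsetP=> u; rewrite !inE -orbA; case/or4P=> /eqP->;
      rewrite ?xa ?ya ?x1a ?y1a.
  - by rewrite Na; apply/subsetP=> u; rewrite !inE; case/orP=> ->; rewrite ?orbT.
  - by rewrite cardsU disjoint_setI0 // cards0 subn0 !cards2 !adjN.
  - by apply: joinableU => //; apply: joinable_edge.
have {}noM x1 y1 : x1 \in V -> y1 \in V -> x1 != a -> y1 != a ->
    adj x x1 -> adj y y1 -> x1 = y1.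
  move=> x1V y1V x1a y1a xx1 yy1; apply: contraNeq noM => x1y1.
  apply/exists_inP; exists x1 => //; apply/exists_inP; exists y1 => //.
  by rewrite x1a y1a xx1 yy1.
have [c [cV xc ca]] := other x xV (etrans (adj_sym _ _) ax).
have [y' [y'V yy' y'a]] := other y yV (etrans (adj_sym _ _) ay).
have yc : adj y c by rewrite (noM c y').
have cx : c != x by rewrite eq_sym adjN.
have cy : c != y by rewrite eq_sym adjN.
have nac : ~~ adj a c by apply/negP=> ac; have := NaE c; rewrite cV ac (negPf cx) (negPf cy).
have [/exists_inP[z zV /and3P[cz zx zy]]|closed_c] :=
    boolP [exists z in V, [&& adj c z, z != x & z != y]].
  have za : z != a by apply: contraNneq nac => <-; rewrite adj_sym.
  left; exists ([set c] :|: [set x; y; z]); split=> //.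
  - by apply/subsetP=> u; rewrite !inE -!orbA; case/or4P=> /eqP->;
      rewrite ?xa ?ya ?za ?ca.
  - by rewrite Na; apply/subsetP=> u; rewrite !inE; case/orP=> ->; rewrite ?orbT.
  - rewrite !cardsU1 !inE (negPf cx) (negPf cy) (negPf (adjN _ _ cz)) /=.
    rewrite setUC cardsU1 !inE (negPf zx) (negPf zy) cards2 (negPf xny).
    by [].
  - apply: linked_joinable.
      apply: linked_setU; rewrite ?linked1 //; first by apply/set0Pn; exists c; rewrite set11.
      move=> u; rewrite !inE -orbA => u3; exists c; rewrite ?set11 //.
      by case/or3P: u3 => /eqP-> //; rewrite adj_sym.
    rewrite cardsU1 setUC cardsU1 cards2 !inE.
    by rewrite (negPf cx) (negPf cy) (negPf (adjN _ _ cz)) (negPf zx) (negPf zy) xny.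
move: closed_c; rewrite negb_exists_in => /forall_inP Nc; right; exists x, c, y.
have acN : a != c by rewrite eq_sym.
split; rewrite ?ax ?xc // 1?[adj c y]adj_sym 1?[adj y a]adj_sym //.
  by rewrite /= !inE !negb_or ![a == _]eq_sym xa ca ya xny [x == c]eq_sym cx cy.
apply/eqP/negPn/negP=> VN.
have [||u [v [uM vV vM uv]]] := linkedP _ lV [set a; x; c; y].
- rewrite properEneq eq_sym VN; apply/subsetP=> u; rewrite !inE -!orbA.
  by case/or4P=> /eqP->.
- by apply/set0Pn; exists y; rewrite !inE eqxx orbT.
move: vM; rewrite !inE !negb_or -!andbA => /and4P[va vx vc vy].
move: uM; rewrite !inE -!orbA => /or4P[]/eqP uE; rewrite uE in uv.
- by have := NaE v; rewrite vV uv (negPf vx) (negPf vy).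
- by move: vc; rewrite (noM v c) ?eqxx.
- by have := Nc v vV; rewrite uv vx vy.
- by move: vc; rewrite -(noM c v) ?eqxx.
Qed.

Lemma exists_join_hub V :
  linked V -> V != set0 -> ~~ odd #|V| ->
  {in V, forall v, ~~ odd #|[set u in V | adj v u]|} ->
  (exists a S, join_hub V a S) \/ (exists a x c y, is_C4 V a x c y).
Proof.
move=> lV /set0Pn[v0 v0V] oV dV.
have [/exists_inP[a aV /eqP da]|d2] :=
    boolP [exists a in V, #|[set u in V | adj a u]| == 2].
  have [[S hS]|[x [c [y C]]]] := join_hub_degree2 lV dV aV da.
    by left; exists a, S.
  by right; exists a, x, c, y.
(* Degrees in [V] are even, differ from 2, and are positive because [V] is connected and, being of
   even order, not a singleton. *)
have dV2 : {in V, forall v, 2 < #|[set u in V | adj v u]|}.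
  move=> v vV; have := dV v vV; have : #|[set u in V | adj v u]| != 2.
    by apply: contraNneq d2 => dv; apply/exists_inP; exists v; rewrite ?dv.
  have : 0 < #|[set u in V | adj v u]|; last by case: #|_| => [|[|[|]]].
  have [||_ [u [/set1P-> uV _ vu]]] := linkedP _ lV [set v].
  - rewrite properEneq sub1set vV andbT.
    by apply: contraNneq oV => <-; rewrite cards1.
  - by apply/set0Pn; exists v; rewrite set11.
  - by rewrite card_gt0; apply/set0Pn; exists u; rewrite inE uV.
(* A vertex adjacent to all others of [V] would have the odd degree [#|V| - 1]. *)
have [b [bV bv0 nv0b]] : exists b, [/\ b \in V, v0 != b & ~~ adj v0 b].
  have : ~~ (V :\ v0 \subset [set u in V | adj v0 u]).
    have := dV v0 v0V; apply: contra => sub; rewrite (_ : [set _ in _ | _] = V :\ v0).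
      by move: oV; rewrite (cardsD1 v0 V) v0V /= negbK.
    apply/eqP; rewrite eqEsubset sub andbT; apply/subsetP=> u.
    rewrite !inE => /andP[-> v0u]; rewrite andbT.
    by apply: contraTneq v0u => ->; rewrite adj_irr.
  case/subsetPn=> b; rewrite !inE => /andP[bv0 bV]; rewrite bV /= => nv0b.
  by exists b; rewrite eq_sym.
have [a [b' [aV b'V ab nab lab]]] := nonadjacent_noncut lV dV2 v0V bV bv0 nv0b.
have oab : ~~ odd #|V :\ a :\ b'|.
  move: oV; rewrite (cardsD1 a V) aV (cardsD1 b' (V :\ a)) !inE b'V eq_sym ab.
  by rewrite /= negbK.
left; exists a, (V :\ a :\ b'); split=> //; first exact: subD1set.
  apply/subsetP=> u; rewrite !inE => /andP[-> au].
  by rewrite andbT; apply/andP; split; apply: contraTneq au => ->; rewrite ?adj_irr.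
exact: linked_joinable.
Qed.

End Joinable.

(** * From symmetric colour functions to odd edge-colourings, and the three colours *)

Lemma set2_inj (T : finType) (v u u' : T) :
  u != v -> u' != v -> [set v; u] = [set v; u'] -> u = u'.
Proof.
move=> uv u'v E; have : u \in [set v; u'] by rewrite -E set22.
by rewrite !inE (negPf uv) => /eqP.
Qed.

(** Lets a colouring be given on ordered pairs instead of two-element sets: since [u] is determined
    by the edge [[set v; u]], degrees in a colour class become counts of neighbours. *)
Lemma odd_edge_colorable_fun (G : sgraph) k (col : G -> G -> 'I_k.+1) :
  (forall u v, col u v = col v u) ->
  (forall v i, [set u | adj v u && (col v u == i)] != set0 ->
     odd #|[set u | adj v u && (col v u == i)]|) ->
  odd_edge_colorable G k.+1.
Proof.
move=> colC oddN.
have adjN (u v : G) : adj u v -> u != v by apply: contraTneq => ->; rewrite adj_irr.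
(* [pick] chooses an orientation of the edge, irrelevant by the symmetry of [col]; the default
   [ord0] is never reached, as every edge has an orientation. *)
pose c : {ffun edge G -> 'I_k.+1} :=
  [ffun f => if [pick p : G * G | adj p.1 p.2 && (val f == [set p.1; p.2])] is Some p
             then col p.1 p.2 else ord0].
have cE (f : edge G) u v : adj u v -> val f = [set u; v] -> c f = col u v.
  move=> uv fE; rewrite ffunE; case: pickP => [[u' v'] /= /andP[uv' /eqP E]|/(_ (u, v))].
    have : u \in [set u'; v'] by rewrite -E fE set21.
    rewrite !inE => /orP[]/eqP uE; subst u.
      by congr (col _ _); apply: (@set2_inj _ u'); rewrite 1?eq_sym ?adjN -?E -?fE.
    rewrite colC; congr (col _ _); apply: (@set2_inj _ v'); rewrite ?adjN //.
      by rewrite adj_sym.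
    by rewrite setUC -E.
  by rewrite /= uv fE eqxx.
have dE v i : degree_in (color_class c i) v = #|[set u | adj v u && (col v u == i)]|.
  rewrite /degree_in -(@card_in_imset _ _ (fun u => [set v; u])); last first.
    move=> u u'; rewrite !inE => /andP[vu _] /andP[vu' _].
    by apply: set2_inj; rewrite eq_sym adjN.
  congr #|pred_of_set _|; apply/setP=> F; rewrite inE.
  apply/andP/imsetP=> [[/imsetP[f fi ->{F}] vf]|[u]].
    rewrite inE in fi; have /imsetP[[x y] /= + fE] := valP f.
    rewrite inE /= => xy; have : v \in [set x; y] by rewrite -fE.
    rewrite !inE => /orP[]/eqP vE; subst v.
      by exists y; rewrite // inE xy -(cE f).
    by exists x; rewrite 1?setUC // inE adj_sym xy colC -(cE f).
  rewrite inE => /andP[vu /eqP ci] ->; split; last by rewrite set21.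
  have eP : [set v; u] \in edges G by apply/imsetP; exists (v, u).
  apply/imsetP; exists (Sub [set v; u] eP : edge G) => //.
  by rewrite inE (cE _ v u) // ci.
apply/existsP; exists c; apply/forallP=> i; apply/implyP=> _.
apply/forall_inP=> v /bigcupP[F FC vF]; rewrite dE oddN // -card_gt0 -dE card_gt0.
by apply/set0Pn; exists F; rewrite inE FC.
Qed.

Lemma join_hub_colorable (G : sgraph) (w a : G) (S : {set G}) :
  (forall v : G, odd (degree v) = (v != w)) ->
  (forall v : G, v != w -> adj w v) ->
  join_hub [set~ w] a S -> odd_edge_colorable G 3.
Proof.
move=> dG dom [aV sSV NaS oS [X [symX subX XS dX]]].
have aw : a != w by rewrite !inE in aV.
have aS : a \notin S by apply/negP=> /(subsetP sSV); rewrite !inE eqxx.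
have Sw u : u \in S -> u != w by move/(subsetP sSV); rewrite !inE => /andP[].
have wS : w \notin S by apply/negP=> /Sw; rewrite eqxx.
have aSn u : u \in S -> u != a by apply: contraTneq => ->.
have Na u : u != w -> adj a u -> u \in S.
  by move=> uw au; apply: (subsetP NaS); rewrite !inE uw.
have Xno v u : v \notin S -> X v u = false by move=> vS; apply: contraNF vS => /XS.
(* Second-colour edges, directed away from their centre [a] or [w]. Below, [c2] is the colour of
   [X], [c1] that of the star edges, and [ord0] that of the rest. *)
pose star u v := (u == a) || [&& u == w, v \in S & ~~ adj a v].
pose c1 : 'I_3 := lift ord0 ord0.
pose c2 : 'I_3 := lift ord0 (lift ord0 ord0).
pose col u v : 'I_3 :=
  if X u v then c2 else if star u v || star v u then c1 else ord0.
pose N v i := [set u | adj v u && (col v u == i)].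
have N2 v : N v c2 = [set u | X v u].
  apply/setP=> u; rewrite !inE /col; case: ifP => [/subX->|_] //.
  by case: ifP => _; rewrite andbF.
have N1 v : N v c1 = [set u | [&& adj v u, ~~ X v u & star v u || star u v]].
  apply/setP=> u; rewrite !inE /col; case: ifP => _; first by rewrite !andbF.
  by case: ifP.
(* The three colour degrees add up to [degree v], so the parity of the third follows from the other
   two. *)
have dN v : odd #|N v ord0| = (v != w) (+) odd #|N v c1| (+) (v \in S).
  have cardN i : \sum_(u in [set u | adj v u] | col v u == i) 1 = #|N v i|.
    by rewrite -sum1_card; apply: eq_bigl => u; rewrite !inE.
  rewrite -dX -N2 -dG /degree -[in odd #|[set u | adj v u]|]sum1_card.
  rewrite (partition_big (col v) predT) //= !big_ord_recl big_ord0 addn0 !oddD !cardN.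
  by case: odd; case: odd; case: odd.
have oN1 v : odd #|N v c1| = [|| v == a, v == w | v \in S].
  have [->|va] /= := eqVneq v a.
    have <- : odd (degree a) = true by rewrite dG.
    congr (odd #|pred_of_set _|); rewrite N1; apply/setP=> u.
    by rewrite !inE Xno // /star eqxx andbT.
  have [->|vw] /= := eqVneq v w.
    have -> : N w c1 = a |: (S :\: [set u | adj a u]).
      rewrite N1; apply/setP=> u; rewrite !inE Xno // /star (negPf wS) !andbF orbF eqxx.
      rewrite [w == a]eq_sym (negPf aw) /= [_ || (u == a)]orbC.
      have [->|ua] := eqVneq u a; first by rewrite dom.
      rewrite andbC /=; case uS: (u \in S); last by rewrite andbF.
      by rewrite dom ?Sw // andbT.
    rewrite cardsU1 !inE (negPf aS) andbF cardsD.
    (* As [degree a] is odd, [a] has an even number of neighbours besides [w], all in [S]; so [S]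
       has evenly many vertices not adjacent to [a], and [a] itself makes the count at [w] odd. *)
    have -> : S :&: [set u | adj a u] = [set u | adj a u] :\ w.
      apply/setP=> u; rewrite !inE; apply/andP/andP=> [[/Sw]|[/Na uS au]] //.
      by split; rewrite ?uS.
    have lt : #|[set u | adj a u] :\ w| <= #|S|.
      by apply/subset_leq_card/subsetP=> u; rewrite !inE => /andP[]; apply: Na.
    rewrite add1n /= oddB // (negPf oS) addFb.
    have := dG a; rewrite /degree (cardsD1 w) inE adj_sym dom // aw add1n /=.
    by move->.
  have [vS|vS] := boolP (v \in S).
    (* A vertex of [S] meets one star edge: to [a] if adjacent to it, to [w] otherwise. *)
    suff -> : N v c1 = [set if adj a v then a else w] by rewrite cards1.
    rewrite N1; apply/setP=> u; rewrite !inE /star (negPf va) (negPf vw) vS /=.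
    case: ifP => [av|nav] /=.
      rewrite andbF orbF; have [->|_] := eqVneq u a; last by rewrite !andbF.
      by rewrite adj_sym av symX Xno.
    rewrite andbT; have [->|ua] := eqVneq u a.
      by rewrite adj_sym nav (negPf aw).
    have [->|_] := eqVneq u w; last by rewrite !andbF.
    by rewrite adj_sym (dom v vw) symX (Xno w v wS).
  rewrite N1 (_ : [set u | _] = set0) ?cards0 //; apply/setP=> u.
  rewrite !inE /star (negPf va) (negPf vw) (negPf vS) /= andbF orbF.
  have [->|_] := eqVneq u a; last by rewrite !andbF.
  by rewrite adj_sym; case: (boolP (adj a v)) => // /(Na _ vw); rewrite (negPf vS).
apply: (@odd_edge_colorable_fun _ _ col) => [u v|v i].
  by rewrite /col symX orbC.
rewrite -/(N v i) => Nv0.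
have : [|| i == ord0, i == c1 | i == c2] by case: i {Nv0} => [[|[|[|]]]].
case/or3P=> /eqP iE.
(* At [a] every edge is a star edge, so this class is empty there; at all other vertices the parity
   formula gives an odd number. *)
- rewrite iE dN oN1; have [va|va] := eqVneq v a.
    case/set0Pn: Nv0 => u; rewrite iE inE va /col Xno // /star eqxx /=.
    by rewrite andbF.
  by case: eqVneq => [->|_]; rewrite ?(negPf wS) //=; case: (v \in S).
- rewrite iE oN1; have [//|va] := eqVneq v a; have [//|vw] := eqVneq v w.
  case/set0Pn: Nv0 => u; rewrite iE N1 inE /star (negPf va) (negPf vw) /=.
  case/and3P=> vu _ /orP[/eqP uE|/and3P[_ -> _]] //.
  by rewrite Na // adj_sym -uE.
- rewrite iE N2 dX; case/set0Pn: Nv0 => u; rewrite iE N2 inE; exact: XS.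
Qed.

(** * Passage to [G - w], the exceptional wheel, and the conclusion *)

(** A cut crossed by no edge would be closed under adjacency in [del_vertex w], so no path could
    leave it. *)
Lemma del_vertex_linked (G : sgraph) (w : G) :
  connected_graph (del_vertex w) -> linked [set~ w].
Proof.
move=> conn; apply/linkedP=> M /properP[sM [z]]; rewrite !inE => zw zM /set0Pn[m mM].
have mw : m != w by have := subsetP sM m mM; rewrite !inE.
have [/exists_inP[u uM /exists_inP[v]]|noE] :=
    boolP [exists u in M, exists v in [set~ w] :\: M, adj u v].
  by rewrite inE => /andP[vM vV] uv; exists u, v.
have stay (x y : del_vertex w) : adj x y -> val x \in M -> val y \in M.
  move=> xy xM; apply: contraNT noE => yM; apply/exists_inP; exists (val x) => //.
  by apply/exists_inP; exists (val y); rewrite // !inE yM (valP y).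
have cl : closed (@adj (del_vertex w)) [pred x | val x \in M].
  move=> x y xy; rewrite !inE; apply/idP/idP; apply: stay => //.
  by rewrite adj_sym.
have := closed_connect cl (conn (Sub m mw) (Sub z zw)).
by rewrite !inE /= mM (negPf zM).
Qed.

Lemma C4_hub_isomorphic_W4 (G : sgraph) (w a x c y : G) :
  (forall v : G, v != w -> adj w v) -> is_C4 [set~ w] a x c y -> isomorphic G W4.
Proof.
move=> dom [uniq4 VE [ax xc cy ya] nac nxy].
have inV u : (u != w) = [|| u == a, u == x, u == c | u == y].
  by have := in_setC1 u w; rewrite VE !inE -!orbA.
pose g (i : option 'I_4) : G := if i is Some i then nth w [:: a; x; c; y] i else w.
have [aw xw cw yw] : [/\ a != w, x != w, c != w & y != w].
  by rewrite !inV !eqxx !orbT.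
have gS i : g (Some i) != w by rewrite /= inV; case: i => [[|[|[|[|]]]]] //= _; rewrite eqxx ?orbT.
have g_inj : injective g.
  move=> [i|] [j|] //.
  - move/eqP; rewrite /g nth_uniq ?ltn_ord // => /eqP ij; congr Some; exact: val_inj.
  - by move=> E; have := gS i; rewrite E eqxx.
  - by move=> E; have := gS j; rewrite -E eqxx.
have g_surj u : exists i, g i = u.
  have [->|] := eqVneq u w; first by exists None.
  rewrite inV => /or4P[]/eqP->.
  - by exists (Some (@Ordinal 4 0 isT)).
  - by exists (Some (@Ordinal 4 1 isT)).
  - by exists (Some (@Ordinal 4 2 isT)).
  - by exists (Some (@Ordinal 4 3 isT)).
have g_mono i j : adj (g i) (g j) = W4_adj i j.
  case: i j => [i|] [j|]; last by rewrite /= adj_irr.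
  - case: i j => [[|[|[|[|//]]]] Hi] [[|[|[|[|//]]]] Hj] /=;
      first [exact: adj_irr | exact: negbTE | by rewrite adj_sym; exact: negbTE
            |by rewrite ?ax ?xc ?cy ?ya |by rewrite adj_sym ?ax ?xc ?cy ?ya].
  - by rewrite adj_sym dom.
  - by rewrite dom.
have gP u : exists i, g i == u by have [i <-] := g_surj u; exists i.
(* The explicit map [g] goes from [W4] to [G], whereas [isomorphic] asks for the other direction;
   [f] is its inverse. *)
pose f (u : G) : W4 := xchoose (gP u).
have fK : cancel f g by move=> u; apply/eqP/(xchooseP (gP u)).
exists f; split; first by exists g => //; apply: inj_can_sym fK g_inj.
by move=> u v; rewrite -{2}[u]fK -{2}[v]fK g_mono.
Qed.

Theorem theorem1p8 (G : sgraph) (w : G)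
    (hconn : connected_graph G)
    (hodd : odd #|G|)
    (heven : [set v : G | ~~ odd (degree v)] = [set w])
    (hdom : forall v : G, v != w -> adj w v)
    (hdel : connected_graph (del_vertex w))
    (hW4 : ~ isomorphic G W4) :
  odd_chromatic_index G <= 3.
Proof.
suff col3 : odd_edge_colorable G 3.
  by rewrite /odd_chromatic_index; case: ex_minnP => m _; apply.
have dG v : odd (degree v) = (v != w).
  by have := in_set1 v w; rewrite -heven inE => <-; rewrite negbK.
have lV := del_vertex_linked hdel.
have oV : ~~ odd #|[set~ w]| by move: hodd; rewrite cardsC1; case: #|_|.
(* Deleting [w] removes exactly one edge at each other vertex, which turns its odd degree even. *)
have dV : {in [set~ w], forall v, ~~ odd #|[set u in [set~ w] | adj v u]|}.
  move=> v; rewrite !inE => vw; have := dG v.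
  rewrite vw /degree (cardsD1 w) inE adj_sym hdom //= => oddN.
  rewrite (_ : [set u in _ | _] = [set u | adj v u] :\ w) ?oddN //.
  by apply/setP=> u; rewrite !inE.
(* If [w] is the only vertex, there are no edges and a constant colouring will do. *)
have [V0|V0] := eqVneq [set~ w] set0.
  apply: (@odd_edge_colorable_fun _ _ (fun _ _ => ord0)) => // v i /set0Pn[u].
  have all_w t : t = w by apply/eqP; have := in_set0 t; rewrite -V0 !inE => /negbFE.
  by rewrite inE (all_w v) (all_w u) adj_irr.
have [[a [S hS]]|[a [x [c [y C]]]]] := exists_join_hub lV V0 oV dV.
  exact: join_hub_colorable hS.
by case: hW4; apply: C4_hub_isomorphic_W4 C.
Qed.
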